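(* Let $A$ be a Banach algebra. (i) Suppose that $A$ is uniformly approximately contractible. Then $A$ is contractible. (ii) Suppose that $A$ is uniformly approximately amenable. Then $A$ is amenable.
   Context: Banach algebras are not assumed unital. A Banach $A$-bimodule is a Banach space with commuting jointly continuous associative left and right actions of $A$. For a Banach $A$-bimodule $X$, the dual $X^*$ is a Banach $A$-bimodule via $(a\cdot f)(x)=f(x\cdot a)$, $(f\cdot a)(x)=f(a\cdot x)$. For $x\in X$, $\operatorname{ad}_x\colon A\to X$ is the inner derivation $a\mapsto[a,x]=a\cdot x-x\cdot a$. $A$ is contractible (respectively, amenable) if for each Banach $A$-bimodule $X$ every continuous derivation from $A$ to $X$ (respectively, to $X^*$) is inner. $A$ is uniformly approximately contractible (respectively, uniformly approximately amenable) if for each Banach $A$-bimodule $X$ and each continuous derivation $D\colon A\to X$ (respectively, $D\colon A\to X^*$) there exists a net $\{x_\nu\}$ in $X$ (respectively, in $X^*$) such that $D=\lim_\nu\operatorname{ad}_{x_\nu}$ in the operator norm topology. *)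

(* Defs.v *)
From HB Require Import structures.
From mathcomp Require Import all_boot all_order all_algebra.
From mathcomp Require Import complex ring.
From mathcomp Require Import boolp classical_sets functions reals.
From mathcomp Require Import topology normedtype.

Set Implicit Arguments.
Unset Strict Implicit.
Unset Printing Implicit Defensive.

Import Order.TTheory GRing.Theory Num.Theory.
Import numFieldNormedType.Exports.

Local Open Scope classical_set_scope.
Local Open Scope ring_scope.
Local Open Scope complex_scope.

(* No unit is required, so the library's ring structures do not apply. *)
HB.mixin Record isBanachAlgebra (K : numFieldType) A
    & CompleteNormedModule K A := {
  amul : A -> A -> A;
  amulA : forall a b c, amul a (amul b c) = amul (amul a b) c;
  amul_linearl : forall b, linear (fun a => amul a b);
  amul_linearr : forall a, linear (amul a);
  amul_norm : forall a b, `|amul a b| <= `|a| * `|b|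
}.

#[short(type="banachAlgType")]
HB.structure Definition BanachAlgebra (K : numFieldType) :=
  {A of CompleteNormedModule K A & isBanachAlgebra K A}.

HB.mixin Record isBanachBimodule (K : numFieldType) (A : banachAlgType K) X
    & CompleteNormedModule K X := {
  lact : A -> X -> X;
  ract : X -> A -> X;
  lact_linearl : forall x, linear (fun a => lact a x);
  lact_linearr : forall a, linear (lact a);
  ract_linearl : forall a, linear (fun x => ract x a);
  ract_linearr : forall x, linear (ract x);
  lactA : forall a b x, lact a (lact b x) = lact (amul a b) x;
  ractA : forall a b x, ract (ract x a) b = ract x (amul a b);
  lract : forall a b x, ract (lact a x) b = lact a (ract x b);
  lact_continuous : continuous (fun p : A * X => lact p.1 p.2);
  ract_continuous : continuous (fun p : X * A => ract p.1 p.2)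
}.

#[short(type="banachBimodType")]
HB.structure Definition BanachBimodule (K : numFieldType)
    (A : banachAlgType K) :=
  {X of CompleteNormedModule K X & isBanachBimodule K A X}.

Section complex_complete.
Variable R : realType.
Local Notation C := R[i].

Lemma complex_cauchy_cvg (F : set_system C^o) :
  ProperFilter F -> cauchy F -> cvg F.
Proof.
move=> FF Fc.
have part_le (p : C -> R) : (p = @complex.Re R \/ p = @complex.Im R) ->
    forall z : C, `|p z| <= complex.Re `|z|.
  move=> Ep [a b]; rewrite normc_def /=.
  by case: Ep => -> /=; rewrite -sqrtr_sqr ler_wsqrtr// ?lerDl ?lerDr sqr_ge0.
have part_cvg (p : C -> R) : (p = @complex.Re R \/ p = @complex.Im R) ->
    exists l : R, forall e : R, 0 < e -> \forall z \near F, `|l - p z| < e.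
  move=> Ep.
  have pB : {morph p : x y / x - y} by case: Ep => -> -[? ?] [? ?].
  pose G : set_system R^o := p @ F.
  have Gc : cauchy G.
    apply/cauchy_ballP => e e0.
    have /cauchy_ballP/(_ e%:C) := Fc; rewrite ltcR => /(_ e0).
    case=> -[P Q] /= [FP FQ] PQ.
    exists (p @` P, p @` Q) => /=.
      by split; [apply: filterS FP|apply: filterS FQ] => z zP; exists z.
    move=> [_ _] /= [[x Px <-] [y Qy <-]].
    have := PQ (x, y) (conj Px Qy); rewrite -!ball_normE /= -pB => xye.
    apply: le_lt_trans (part_le p Ep _) _.
    by move: xye; rewrite ltcE => /andP[].
  have /cvg_ex[l /= Gl] : cvg G by exact: R_complete.
  exists l => e e0.
  by move/cvgrPdist_lt : Gl => /(_ e e0).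
have [a Fa] := part_cvg _ (or_introl erefl).
have [b Fb] := part_cvg _ (or_intror erefl).
apply/cvg_ex; exists (a +i* b); apply/cvgrPdist_lt => e e0.
have [Ree0 eE] : 0 < complex.Re e /\ e = (complex.Re e)%:C.
  by move: e0; rewrite ltcE /= => /andP[/eqP]; case: (e) => ? ? /= ->.
have e20 : 0 < complex.Re e / 2 by rewrite divr_gt0.
have decomp (z : C) :
    a +i* b - z = (a - complex.Re z)%:C + 'i%C * (b - complex.Im z)%:C.
  by case: z => u v; simpc.
near=> z.
have za : `|a - complex.Re z| < complex.Re e / 2 by near: z; exact: Fa.
have zb : `|b - complex.Im z| < complex.Re e / 2 by near: z; exact: Fb.
rewrite decomp.
apply: le_lt_trans (ler_normD _ _) _; rewrite normrM.
have -> : `|'i%C : C| = 1 by rewrite normc_def/= expr0n/= add0r expr1n sqrtr1.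
have nR (r : R) : `|r%:C| = `|r|%:C.
  by rewrite normc_def/= expr0n/= addr0 sqrtr_sqr.
by rewrite mul1r !nR eE -rmorphD/= ltcR [ltRHS](splitr _) ltrD.
Unshelve. all: by end_near. Qed.

End complex_complete.

Section continuous_linear_maps.
Variables (R : realType) (E F : normedModType R[i]).

Definition continuous_linear_pred : {pred (E -> F)} :=
  [pred f : E -> F | `[< linear f /\ continuous f >]].

Lemma continuous_linear_submod_closed : submod_closed continuous_linear_pred.
Proof.
split=> [|a f g].
  apply/asboolP; split; first by move=> a x y /=; rewrite scaler0 addr0.
  exact: cst_continuous.
move=> /asboolP[lf cf] /asboolP[lg cg]; apply/asboolP; split.
  move=> b x y; rewrite !fctE lf lg !scalerDr !scalerA (mulrC b a).
  by rewrite addrACA.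
move=> x; rewrite /continuous_at !fctE; apply: cvgD; last exact: cg.
by apply: cvgZr; exact: cf.
Qed.

HB.instance Definition _ := GRing.isSubmodClosed.Build _ _
  continuous_linear_pred continuous_linear_submod_closed.

Record cont_lin := ContLin {
  cont_lin_fun :> E -> F;
  cont_linP : cont_lin_fun \in continuous_linear_pred }.

HB.instance Definition _ := [isSub for cont_lin_fun].
HB.instance Definition _ := [Choice of cont_lin by <:].
HB.instance Definition _ := [SubChoice_isSubLmodule of cont_lin by <:].

End continuous_linear_maps.

Section operator_norm.
Variables (R : realType) (E F : normedModType R[i]).
Implicit Types f g : cont_lin E F.

Lemma ReK_norm (V : normedModType R[i]) (x : V) :
  (complex.Re `|x|)%:C = `|x|.
Proof. by rewrite RRe_real// normr_real. Qed.

Lemma cont_lin_linear f : linear f.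
Proof. by have /asboolP[] := cont_linP f. Qed.

Lemma cont_lin_continuous f : continuous f.
Proof. by have /asboolP[] := cont_linP f. Qed.

HB.instance Definition _ f :=
  GRing.isLinear.Build R[i] E F *:%R f (cont_lin_linear f).

Definition mk_cont_lin (f : E -> F) (lf : linear f) (cf : continuous f) :
  cont_lin E F := @ContLin R E F f (asboolT (conj lf cf)).

Lemma cont_linE f g x : (f + g) x = f x + g x. Proof. by []. Qed.
Lemma cont_linN f x : (- f) x = - f x. Proof. by []. Qed.
Lemma cont_linB f g x : (f - g) x = f x - g x. Proof. by []. Qed.
Lemma cont_linZ a f x : (a *: f) x = a *: f x. Proof. by []. Qed.

Lemma cont_lin_ext f g : (forall x, f x = g x) -> f = g.
Proof. by move=> fg; apply/val_inj/funext. Qed.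

(* The norm of a space over R[i] takes its (real) values in R[i], whereas
   suprema are taken in R, hence the real part. *)
Definition opnorm f : R :=
  sup [set complex.Re `|f x| | x in [set x : E | `|x| <= 1]].

Lemma real_ge0E (c : R[i]) : 0 <= c -> c = (complex.Re c)%:C.
Proof. by move=> c0; rewrite RRe_real// ger0_real. Qed.

Lemma cont_lin_bounded f :
  exists2 M : R, 0 <= M & forall x, `|f x| <= M%:C * `|x|.
Proof.
have /linear_bounded_continuous/linear_boundedP := @cont_lin_continuous f.
move=> /pinfty_ex_gt0[M M0 fM]; exists (complex.Re M).
  by rewrite -lecR -real_ge0E// ltW.
by move=> x; rewrite -real_ge0E ?fM// ltW.
Qed.

Lemma has_sup_opnorm f :
  has_sup [set complex.Re `|f x| | x in [set x : E | `|x| <= 1]].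
Proof.
split; first by exists (complex.Re `|f 0|), 0 => //=; rewrite normr0 ler01.
have [M M0 fM] := cont_lin_bounded f.
exists M => _ [x /= x1 <-]; rewrite -lecR ReK_norm.
by apply: le_trans (fM x) _; rewrite ler_piMr// ler0c.
Qed.

Lemma opnorm_ge0 f : 0 <= opnorm f.
Proof.
apply: (@le_trans _ _ (complex.Re `|f 0|)); first by rewrite -ler0c ReK_norm.
apply: (ub_le_sup (has_sup_opnorm f).2); exists 0 => //=.
by rewrite normr0 ler01.
Qed.

Lemma opnormP f x : `|f x| <= (opnorm f)%:C * `|x|.
Proof.
have [->|x0] := eqVneq x 0; first by rewrite linear0 !normr0 mulr0.
have nx0 : 0 < `|x| by rewrite normr_gt0.
rewrite -ler_pdivrMr// mulrC -[X in X * _]ger0_norm ?invr_ge0//.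
rewrite -normrZ -linearZ -(ReK_norm (f _)) lecR.
apply: (ub_le_sup (has_sup_opnorm f).2); exists (`|x|^-1 *: x) => //=.
by rewrite normrZ normfV normr_id mulVf// gt_eqF.
Qed.

Lemma opnorm_le f (M : R) : 0 <= M ->
  (forall x, `|f x| <= M%:C * `|x|) -> opnorm f <= M.
Proof.
move=> M0 fM; apply: ge_sup; first exact: (has_sup_opnorm f).1.
move=> _ [x /= x1 <-]; rewrite -lecR ReK_norm.
by apply: le_trans (fM x) _; rewrite ler_piMr// ler0c.
Qed.

Let opnormC f : R[i] := (opnorm f)%:C.

Let opnormD f g : opnormC (f + g) <= opnormC f + opnormC g.
Proof.
rewrite /opnormC -rmorphD lecR; apply: opnorm_le => [|x].
  by rewrite addr_ge0// opnorm_ge0.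
rewrite cont_linE rmorphD mulrDl; apply: le_trans (ler_normD _ _) _.
by rewrite lerD// opnormP.
Qed.

Let opnormZ (a : R[i]) f : opnormC (a *: f) = `|a| * opnormC f.
Proof.
have le1 (b : R[i]) (g : cont_lin E F) :
    opnormC (b *: g) <= `|b| * opnormC g.
  rewrite -(ReK_norm (b : R[i]^o)) /opnormC -rmorphM lecR.
  apply: opnorm_le => [|x].
    by rewrite mulr_ge0 ?opnorm_ge0// -ler0c (ReK_norm (b : R[i]^o)).
  rewrite cont_linZ normrZ rmorphM [X in _ <= X * _ * _](_ : _ = `|b|);
    last exact: (ReK_norm (b : R[i]^o)).
  rewrite -mulrA.
  by rewrite ler_wpM2l// opnormP.
apply/eqP; rewrite eq_le le1/=.
have [->|a0] := eqVneq a 0; first by rewrite normr0 mul0r ler0c opnorm_ge0.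
have := le1 a^-1 (a *: f); rewrite scalerA mulVf// scale1r normfV.
by rewrite ler_pdivlMl// normr_gt0.
Qed.

Let opnorm_eq0 f : opnormC f = 0 -> f = 0.
Proof.
move=> f0; apply: cont_lin_ext => x; apply/eqP; rewrite -normr_le0.
by apply: le_trans (opnormP f x) _; rewrite -/(opnormC f) f0 mul0r.
Qed.

HB.instance Definition _ := Lmodule_isNormed.Build R[i] (cont_lin E F)
  opnormD opnormZ opnorm_eq0.

Lemma cont_lin_normE f : `|f| = (opnorm f)%:C. Proof. by []. Qed.

Lemma cont_lin_normP f x : `|f x| <= `|f| * `|x|.
Proof. exact: opnormP. Qed.

Lemma cont_lin_norm_le f (M : R[i]) : 0 <= M ->
  (forall x, `|f x| <= M * `|x|) -> `|f| <= M.
Proof.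
move=> M0 fM; rewrite cont_lin_normE (real_ge0E M0) lecR.
by apply: opnorm_le => [|x]; rewrite -?lecR -real_ge0E.
Qed.

End operator_norm.

Section cont_lin_complete.
Variables (R : realType) (E F : normedModType R[i]).

Lemma linear_bounded_cont (f : E -> F) (M : R[i]) :
  0 <= M -> linear f -> (forall x, `|f x| <= M * `|x|) -> continuous f.
Proof.
move=> M0 lf fM.
pose g : {linear E -> F} := HB.pack f (GRing.isLinear.Build _ _ _ _ _ lf).
apply: (@bounded_linear_continuous _ _ _ g); apply/linear_boundedP.
near=> r => x; apply: le_trans (fM x) _; rewrite ler_wpM2r//.
by near: r; apply: nbhs_pinfty_ge; rewrite ger0_real.
Unshelve. all: by end_near. Qed.

Hypothesis F_complete :
  forall H : set_system F, ProperFilter H -> cauchy H -> cvg H.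

Lemma cont_lin_cauchy_cvg (G : set_system (cont_lin E F)) :
  ProperFilter G -> cauchy G -> cvg G.
Proof.
move=> GF /cauchy_ballP Gc.
have small (e : R[i]) : 0 < e -> exists2 P, G P &
    forall f g, P f -> P g -> forall x, `|f x - g x| <= e * `|x|.
  move=> e0; have [[P Q] /= [GP GQ] PQ] := Gc e e0.
  exists (P `&` Q); first exact: filterI.
  move=> f g [Pf Qf] [Pg Qg] x; rewrite -cont_linB.
  apply: le_trans (cont_lin_normP _ _) _; rewrite ler_wpM2r// ltW//.
  by have := PQ (f, g) (conj Pf Qg); rewrite -ball_normE.
pose ev x (f : cont_lin E F) := f x.
have evc x : cvg (ev x @ G).
  apply: F_complete; apply/cauchy_ballP => e e0.
  have d0 : 0 < e / (`|x| + 1) by rewrite divr_gt0// ltr_wpDl.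
  have [P GP PP] := small _ d0.
  exists (ev x @` P, ev x @` P) => /=.
    by split; apply: (@filterS _ G _ P) => // f Pf; exists f.
  move=> [_ _] /= [[f Pf <-] [g Pg <-]]; rewrite -ball_normE /=.
  apply: le_lt_trans (PP f g Pf Pg x) _.
  by rewrite mulrAC ltr_pdivrMr ?ltr_wpDl// ltr_pM2l// ltrDl.
pose l x := lim (ev x @ G).
have ll : linear l.
  move=> a x y; rewrite [LHS]/l; apply: cvg_lim; first exact: norm_hausdorff.
  rewrite [X in X @ _](_ : _ = fun f => a *: ev x f + ev y f); last first.
    by apply/funext => f; rewrite /ev linearP.
  by apply: cvgD; [apply: cvgZr; exact: evc|exact: evc].
have lP (e : R[i]) : 0 < e -> exists2 P, G P &
    forall f, P f -> forall x, `|f x - l x| <= e * `|x|.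
  move=> e0; have [P GP PP] := small e e0; exists P => // f Pf x.
  apply/ler_addgt0Pr => d d0.
  have /cvgrPdist_lt/(_ d d0) Gx := evc x.
  have [g [Pg gd]] := filter_ex (filterI GP Gx).
  rewrite -(subrKA (g x)); apply: le_trans (ler_normD _ _) _.
  by rewrite lerD ?PP// distrC ltW.
have lc : continuous l.
  have [P GP PP] := lP 1 ltr01; have [f Pf] := filter_ex GP.
  apply: (@linear_bounded_cont _ (`|f| + 1)) => // [|x].
    by rewrite addr_ge0.
  rewrite -[l x](subKr (f x)) mulrDl; apply: le_trans (ler_normB _ _) _.
  by rewrite lerD ?PP ?cont_lin_normP.
apply/cvg_ex; exists (mk_cont_lin ll lc); apply/cvgrPdist_le => e e0.
have [P GP PP] := lP e e0; apply: filterS GP => f Pf.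
rewrite distrC; apply: cont_lin_norm_le => [|x]; first exact: ltW.
by rewrite cont_linB PP.
Qed.

End cont_lin_complete.

Section bilinear_continuity.
Variables (R : realType) (U V W : normedModType R[i]) (b : U -> V -> W).
Hypotheses (bl : forall v, linear (fun u => b u v)).
Hypotheses (br : forall u, linear (b u)).

Let L v : {linear U -> W} :=
  HB.pack (fun u => b u v) (GRing.isLinear.Build _ _ _ _ _ (bl v)).
Let L' u : {linear V -> W} :=
  HB.pack (b u) (GRing.isLinear.Build _ _ _ _ _ (br u)).

Lemma bilinear_continuous_bounded :
  continuous (fun p : U * V => b p.1 p.2) ->
  exists2 M : R[i], 0 <= M & forall u v, `|b u v| <= M * `|u| * `|v|.
Proof.
move=> /(_ (0, 0)) /cvgrPdist_lt /(_ 1 ltr01).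
rewrite /= -[b 0 0]/(L 0 0) linear0.
case=> -[P Q] /= [/nbhs_normP[/= d d0 dP] /nbhs_normP[/= e e0 eQ]] PQ.
exists ((d / 2)^-1 / (e / 2)).
  by rewrite divr_ge0// ?invr_ge0 divr_ge0// ltW.
move=> u v.
have [->|u0] := eqVneq u 0.
  by rewrite -[b 0 v]/(L v 0) linear0 !normr0 mulr0 mul0r.
have [->|v0] := eqVneq v 0.
  by rewrite -[b u 0]/(L' u 0) linear0 !normr0 mulr0.
have nu : 0 < `|u| by rewrite normr_gt0.
have nv : 0 < `|v| by rewrite normr_gt0.
have d20 : 0 < d / 2 by rewrite divr_gt0.
have e20 : 0 < e / 2 by rewrite divr_gt0.
pose s := d / 2 / `|u|; pose t := e / 2 / `|v|.
have s0 : 0 < s by rewrite divr_gt0.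
have t0 : 0 < t by rewrite divr_gt0.
have Pu : P (s *: u).
  apply: dP => /=; rewrite sub0r normrN normrZ gtr0_norm// divfK ?gt_eqF//.
  by rewrite ltr_pdivrMr// ltr_pMr// ltr1n.
have Qv : Q (t *: v).
  apply: eQ => /=; rewrite sub0r normrN normrZ gtr0_norm// divfK ?gt_eqF//.
  by rewrite ltr_pdivrMr// ltr_pMr// ltr1n.
have := PQ (s *: u, t *: v) (conj Pu Qv); rewrite /= sub0r normrN.
rewrite -[b _ _]/(L (t *: v) (s *: u)) linearZ/=.
rewrite -[b _ _]/(L' u (t *: v)) linearZ/= !normrZ (gtr0_norm s0) (gtr0_norm t0).
rewrite mulrA -(ltr_pdivlMl _ _ (mulr_gt0 s0 t0)) mulr1 => /ltW/le_trans; apply.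
rewrite le_eqVlt; apply/orP; left; apply/eqP.
by rewrite /s /t !invfM !invrK [RHS]mulrAC; ring.
Qed.

Lemma bilinear_bounded_continuous (M : R[i]) : 0 <= M ->
  (forall u v, `|b u v| <= M * `|u| * `|v|) ->
  continuous (fun p : U * V => b p.1 p.2).
Proof.
move=> M0 bM [u v]; apply/cvgrPdist_lt => e e0 /=.
pose c := M * (`|u| + `|v| + 1) + 1.
have c0 : 0 < c by rewrite ltr_wpDl// mulr_ge0// !addr_ge0.
have ec0 : 0 < e / 2 / c by rewrite !divr_gt0.
have bB (p : U * V) : b u v - b p.1 p.2 = b (u - p.1) p.2 + b u (v - p.2).
  rewrite -[b (u - _) _]/(L _ _) linearB -[b u (v - _)]/(L' _ _) linearB /=.
  by rewrite [RHS]addrC subrKA.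
near=> p; rewrite bB (le_lt_trans (ler_normD _ _))// (splitr e).
have pu : `|u - p.1| < e / 2 / c.
  near: p; apply: (@cvgr_dist_lt _ _ _ _ _ fst) => //; exact: cvg_fst.
have pv : `|v - p.2| < e / 2 / c.
  near: p; apply: (@cvgr_dist_lt _ _ _ _ _ snd) => //; exact: cvg_snd.
have pv1 : `|p.2| <= `|v| + 1.
  have vp1 : `|v - p.2| < 1.
    near: p; apply: (@cvgr_dist_lt _ _ _ _ _ snd) => //; exact: cvg_snd.
  rewrite -[p.2](subKr v); apply: le_trans (ler_normB _ _) _.
  by rewrite lerD2l ltW.
have Mc (x : R[i]) : 0 <= x <= `|u| + `|v| + 1 -> M * x <= c.
  move=> /andP[x0 xl]; apply: le_trans (_ : M * (`|u| + `|v| + 1) <= _).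
    by rewrite ler_wpM2l.
  by rewrite lerDl.
have half (x y : R[i]) : 0 <= x -> x <= c -> 0 <= y -> y < e / 2 / c ->
    x * y < e / 2.
  move=> x0 xc y0 ye; apply: le_lt_trans (_ : c * y < _).
    by rewrite ler_wpM2r.
  by rewrite mulrC -ltr_pdivlMr.
apply: ltrD.
  apply: le_lt_trans (bM _ _) _; rewrite mulrAC half ?mulr_ge0// Mc//.
  by rewrite normr_ge0/= (le_trans pv1)// lerD2r lerDr.
apply: le_lt_trans (bM _ _) _; rewrite half ?mulr_ge0// Mc//.
by rewrite normr_ge0/= -addrA lerDl addr_ge0.
Unshelve. all: by end_near. Qed.

End bilinear_continuity.

Definition dual (R : realType) (X : normedModType R[i]) : Type :=
  cont_lin X R[i]^o.

HB.instance Definition _ (R : realType) (X : normedModType R[i]) :=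
  NormedModule.copy (dual X) (cont_lin X R[i]^o).

HB.instance Definition _ (R : realType) (X : normedModType R[i]) :=
  Uniform_isComplete.Build (dual X)
    (cont_lin_cauchy_cvg (@complex_cauchy_cvg R)).

Section dual_bimodule.
Variables (R : realType) (A : banachAlgType R[i]) (X : banachBimodType A).

Lemma lact_bounded : exists2 M : R[i], 0 <= M &
  forall (a : A) (x : X), `|lact a x| <= M * `|a| * `|x|.
Proof.
apply: bilinear_continuous_bounded lact_continuous.
- exact: lact_linearl.
- exact: lact_linearr.
Qed.

Lemma ract_bounded : exists2 M : R[i], 0 <= M &
  forall (x : X) (a : A), `|ract x a| <= M * `|x| * `|a|.
Proof.
apply: bilinear_continuous_bounded ract_continuous.
- exact: ract_linearl.
- exact: ract_linearr.
Qed.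

Implicit Types (a : A) (f : dual X).

Let dual_lact_linear a f : linear (fun x => f (ract x a) : R[i]^o).
Proof. by move=> c x y; rewrite ract_linearl cont_lin_linear. Qed.

Let dual_lact_continuous a f : continuous (fun x => f (ract x a) : R[i]^o).
Proof.
have [M M0 rM] := ract_bounded.
apply: (@linear_bounded_cont _ _ _ _ (`|f| * (M * `|a|))) => // [|x].
  by rewrite !mulr_ge0.
apply: le_trans (cont_lin_normP _ _) _; rewrite -mulrA ler_wpM2l//.
by rewrite mulrAC.
Qed.

Let dual_ract_linear a f : linear (fun x => f (lact a x) : R[i]^o).
Proof. by move=> c x y; rewrite lact_linearr cont_lin_linear. Qed.

Let dual_ract_continuous a f : continuous (fun x => f (lact a x) : R[i]^o).
Proof.
have [M M0 lM] := lact_bounded.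
apply: (@linear_bounded_cont _ _ _ _ (`|f| * (M * `|a|))) => // [|x].
  by rewrite !mulr_ge0.
by apply: le_trans (cont_lin_normP _ _) _; rewrite -mulrA ler_wpM2l.
Qed.

Definition dual_lact a f : dual X :=
  mk_cont_lin (dual_lact_linear a f) (@dual_lact_continuous a f).
Definition dual_ract f a : dual X :=
  mk_cont_lin (dual_ract_linear a f) (@dual_ract_continuous a f).

Let dual_lact_linearl f : linear (fun a => dual_lact a f).
Proof.
move=> c a b; apply: cont_lin_ext => x /=.
by rewrite ract_linearr cont_lin_linear.
Qed.

Let dual_lact_linearr a : linear (dual_lact a).
Proof. by move=> c f g; apply: cont_lin_ext. Qed.

Let dual_ract_linearl a : linear (fun f => dual_ract f a).
Proof. by move=> c f g; apply: cont_lin_ext. Qed.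

Let dual_ract_linearr f : linear (dual_ract f).
Proof.
move=> c a b; apply: cont_lin_ext => x /=.
by rewrite lact_linearl cont_lin_linear.
Qed.

Let dual_lactA a b f :
  dual_lact a (dual_lact b f) = dual_lact (amul a b) f.
Proof. by apply: cont_lin_ext => x /=; rewrite ractA. Qed.

Let dual_ractA a b f :
  dual_ract (dual_ract f a) b = dual_ract f (amul a b).
Proof. by apply: cont_lin_ext => x /=; rewrite lactA. Qed.

Let dual_lract a b f :
  dual_ract (dual_lact a f) b = dual_lact a (dual_ract f b).
Proof. by apply: cont_lin_ext => x /=; rewrite lract. Qed.

Let dual_lact_jcontinuous :
  continuous (fun p : A * dual X => dual_lact p.1 p.2).
Proof.
have [M M0 rM] := ract_bounded.
apply: (bilinear_bounded_continuous dual_lact_linearl dual_lact_linearr M0).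
move=> a f; apply: cont_lin_norm_le => [|x]; first by rewrite !mulr_ge0.
apply: le_trans (cont_lin_normP f (ract x a)) _.
apply: le_trans (ler_wpM2l (normr_ge0 _) (rM _ _)) _.
by rewrite le_eqVlt; apply/orP; left; apply/eqP; ring.
Qed.

Let dual_ract_jcontinuous :
  continuous (fun p : dual X * A => dual_ract p.1 p.2).
Proof.
have [M M0 lM] := lact_bounded.
apply: (bilinear_bounded_continuous dual_ract_linearl dual_ract_linearr M0).
move=> f a; apply: cont_lin_norm_le => [|x]; first by rewrite !mulr_ge0.
apply: le_trans (cont_lin_normP f (lact a x)) _.
apply: le_trans (ler_wpM2l (normr_ge0 _) (lM _ _)) _.
by rewrite le_eqVlt; apply/orP; left; apply/eqP; ring.
Qed.

HB.instance Definition _ := isBanachBimodule.Build R[i] A (dual X)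
  dual_lact_linearl dual_lact_linearr dual_ract_linearl dual_ract_linearr
  dual_lactA dual_ractA dual_lract
  dual_lact_jcontinuous dual_ract_jcontinuous.

End dual_bimodule.

Lemma dual_lactE (R : realType) (A : banachAlgType R[i])
  (X : banachBimodType A) (a : A) (f : dual X) (x : X) :
  lact a f x = f (ract x a).
Proof. by []. Qed.

Lemma dual_ractE (R : realType) (A : banachAlgType R[i])
  (X : banachBimodType A) (a : A) (f : dual X) (x : X) :
  ract f a x = f (lact a x).
Proof. by []. Qed.

Section derivations.
Variables (R : realType) (A : banachAlgType R[i]) (X : banachBimodType A).

Let ad_linear (x : X) : linear (fun a : A => lact a x - ract x a).
Proof.
move=> c a b; rewrite lact_linearl ract_linearr scalerBr.
by rewrite opprD addrACA.
Qed.

Let ad_continuous (x : X) : continuous (fun a : A => lact a x - ract x a).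
Proof.
have [M M0 lM] := lact_bounded X; have [N N0 rN] := ract_bounded X.
apply: (@linear_bounded_cont _ _ _ _ ((M + N) * `|x|)) => // [|a].
  by rewrite mulr_ge0// addr_ge0.
apply: le_trans (ler_normB _ _) _; apply: le_trans (lerD (lM _ _) (rN _ _)) _.
by rewrite le_eqVlt; apply/orP; left; apply/eqP; ring.
Qed.

Definition ad (x : X) : cont_lin A X :=
  mk_cont_lin (ad_linear x) (@ad_continuous x).

Definition derivation (D : cont_lin A X) : Prop :=
  forall a b : A, D (amul a b) = lact a (D b) + ract (D a) b.

Definition inner (D : cont_lin A X) : Prop := exists x : X, D = ad x.

End derivations.

Record directed (I : Type) (le : I -> I -> Prop) : Prop := Directed {
  directed_inhabited : inhabited I;
  directed_refl : forall i, le i i;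
  directed_trans : forall i j k, le i j -> le j k -> le i k;
  directed_ub : forall i j, exists k, le i k /\ le j k
}.

(* A net converges when its image of this filter does. *)
Definition tails (I : Type) (le : I -> I -> Prop) : set_system I :=
  [set S : set I | exists i, forall j, le i j -> S j].

(* Convergence is in the topology of the normed module cont_lin A X,
   i.e. in the operator norm. *)
Definition uniformly_approx_inner (R : realType) (A : banachAlgType R[i])
    (X : banachBimodType A) (D : cont_lin A X) : Prop :=
  exists (I : Type) (le : I -> I -> Prop) (x : I -> X),
    directed le /\ ad (x i) @[i --> tails le] --> D.

Section amenability.
Variables (R : realType) (A : banachAlgType R[i]).

Definition contractible : Prop :=
  forall (X : banachBimodType A) (D : cont_lin A X),
    derivation D -> inner D.

Definition amenable : Prop :=
  forall (X : banachBimodType A) (D : cont_lin A (dual X)),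
    derivation D -> inner D.

Definition uniformly_approx_contractible : Prop :=
  forall (X : banachBimodType A) (D : cont_lin A X),
    derivation D -> uniformly_approx_inner D.

Definition uniformly_approx_amenable : Prop :=
  forall (X : banachBimodType A) (D : cont_lin A (dual X)),
    derivation D -> uniformly_approx_inner D.

End amenability.

(* Main.v *)
Require Import Defs.
From HB Require Import structures.
From mathcomp Require Import all_boot all_order all_algebra.
From mathcomp Require Import complex.
From mathcomp Require Import reals.
From mathcomp Require Import ring boolp classical_sets.
From mathcomp Require Import topology normedtype.

Set Implicit Arguments.
Unset Strict Implicit.
Unset Printing Implicit Defensive.

Import Order.TTheory GRing.Theory Num.Theory.
Import numFieldNormedType.Exports.

Local Open Scope classical_set_scope.
Local Open Scope ring_scope.
Local Open Scope complex_scope.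

(** Fix a Banach bimodule X and let Z be the space of all bounded derivations
    from A to X. Both parts say that ad : X -> Z is onto (with a dual
    bimodule as X in the second one), while the hypothesis only says that
    its range is dense. Two ideas close the gap.

    The first is that density becomes quantitative when the hypothesis is
    applied to all derivations at once. The bounded operators from Z to X form
    a Banach bimodule, with A acting on the values, and evaluation sends a in
    A to the operator z |-> z a. This is itself a bounded derivation
    ([universal_derivationP]). If ad T lies within 1/2 of it in norm, then
    every z in Z satisfies |z - ad (T z)| <= |z| / 2 and |T z| <= |T| |z|. So
    each z is approximated, up to half its size, by an inner derivation whose
    implementing element is controlled by |z|. Correcting the error again and
    again gives a convergent series in the complete space X, whose sum
    implements z exactly ([approx_surjective],
    [derivations_inner_of_approx]).

    The second idea deals with dual bimodules. Write W for the bimodule of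
    operators from Z to X^*. The hypothesis concerns derivations into duals,
    so the universal derivation is followed by the canonical embedding of W
    into its bidual, which is a bimodule map ([bidual_derivationP]). This
    gives F in W^** in place of T. To come back to X^*, observe that z in Z and
    x in X define a functional w |-> w z x on W, of norm at most |z| |x|, on
    which A acts through x alone ([elementary_lact], [elementary_ract]);
    hence z |-> (x |-> F (w |-> w z x)) plays the role of T
    ([contract_ad_dist], [contract_norm]). *)

(** * Operators with values in a bimodule *)

Section operator_bimodule.
Variables (R : realType) (A : banachAlgType R[i]) (E : normedModType R[i]).

Definition operators (X : banachBimodType A) : Type := cont_lin E X.

HB.instance Definition _ (X : banachBimodType A) :=
  NormedModule.copy (operators X) (cont_lin E X).

HB.instance Definition _ (X : banachBimodType A) :=
  Uniform_isComplete.Build (operators X)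
    (cont_lin_cauchy_cvg (@cauchy_cvg X)).

Variable X : banachBimodType A.
Implicit Types (a b : A) (T : operators X).

Let op_lact_linear a T : linear (fun z => lact a (T z)).
Proof. by move=> c y z; rewrite cont_lin_linear lact_linearr. Qed.

Let op_ract_linear a T : linear (fun z => ract (T z) a).
Proof. by move=> c y z; rewrite cont_lin_linear ract_linearl. Qed.

Let op_lact_bounded : exists2 M : R[i], 0 <= M &
  forall a T z, `|lact a (T z)| <= M * `|a| * `|T| * `|z|.
Proof.
have [M M0 lM] := lact_bounded X; exists M => // a T z.
apply: le_trans (lM _ _) _; rewrite -[leRHS]mulrA ler_wpM2l ?mulr_ge0//.
exact: cont_lin_normP.
Qed.

Let op_ract_bounded : exists2 M : R[i], 0 <= M &
  forall T a z, `|ract (T z) a| <= M * `|T| * `|a| * `|z|.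
Proof.
have [M M0 rM] := ract_bounded X; exists M => // T a z.
apply: le_trans (rM _ _) _; rewrite [leRHS]mulrAC ler_wpM2r//.
by rewrite -mulrA ler_wpM2l// cont_lin_normP.
Qed.

Let op_lact_continuous a T : continuous (fun z => lact a (T z)).
Proof.
have [M M0 lM] := op_lact_bounded.
by apply: linear_bounded_cont (lM a T); rewrite ?mulr_ge0.
Qed.

Let op_ract_continuous a T : continuous (fun z => ract (T z) a).
Proof.
have [M M0 rM] := op_ract_bounded.
by apply: linear_bounded_cont (rM T a); rewrite ?mulr_ge0.
Qed.

Definition op_lact a T : operators X :=
  mk_cont_lin (op_lact_linear a T) (@op_lact_continuous a T).
Definition op_ract T a : operators X :=
  mk_cont_lin (op_ract_linear a T) (@op_ract_continuous a T).

Let op_lact_linearl T : linear (fun a => op_lact a T).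
Proof. by move=> c a b; apply: cont_lin_ext => z; apply: lact_linearl. Qed.

Let op_lact_linearr a : linear (op_lact a).
Proof. by move=> c S T; apply: cont_lin_ext => z; apply: lact_linearr. Qed.

Let op_ract_linearl a : linear (fun T => op_ract T a).
Proof. by move=> c S T; apply: cont_lin_ext => z; apply: ract_linearl. Qed.

Let op_ract_linearr T : linear (op_ract T).
Proof. by move=> c a b; apply: cont_lin_ext => z; apply: ract_linearr. Qed.

Let op_lactA a b T : op_lact a (op_lact b T) = op_lact (amul a b) T.
Proof. by apply: cont_lin_ext => z; apply: lactA. Qed.

Let op_ractA a b T : op_ract (op_ract T a) b = op_ract T (amul a b).
Proof. by apply: cont_lin_ext => z; apply: ractA. Qed.

Let op_lract a b T : op_ract (op_lact a T) b = op_lact a (op_ract T b).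
Proof. by apply: cont_lin_ext => z; apply: lract. Qed.

Let op_lact_jcontinuous :
  continuous (fun p : A * operators X => op_lact p.1 p.2).
Proof.
have [M M0 lM] := op_lact_bounded.
apply: (bilinear_bounded_continuous op_lact_linearl op_lact_linearr M0).
by move=> a T; apply: cont_lin_norm_le => [|z]; rewrite ?mulr_ge0// lM.
Qed.

Let op_ract_jcontinuous :
  continuous (fun p : operators X * A => op_ract p.1 p.2).
Proof.
have [M M0 rM] := op_ract_bounded.
apply: (bilinear_bounded_continuous op_ract_linearl op_ract_linearr M0).
by move=> T a; apply: cont_lin_norm_le => [|z]; rewrite ?mulr_ge0// rM.
Qed.

HB.instance Definition _ := isBanachBimodule.Build R[i] A (operators X)
  op_lact_linearl op_lact_linearr op_ract_linearl op_ract_linearr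
  op_lactA op_ractA op_lract op_lact_jcontinuous op_ract_jcontinuous.

End operator_bimodule.

(** * The normed space of bounded derivations *)

Section derivation_space.
Variables (R : realType) (A : banachAlgType R[i]) (X : banachBimodType A).

Definition derivation_pred : {pred cont_lin A X} :=
  [pred D | `[< derivation D >]].

Lemma derivation_submod_closed : submod_closed derivation_pred.
Proof.
split=> [|c D1 D2 /asboolP d1 /asboolP d2]; apply/asboolP => a b.
  have l0 : lact a (0 : X) = 0.
    have := lact_linearr a (-1) (0 : X) 0.
    by rewrite scaler0 add0r scaleN1r addNr.
  have r0 : ract (0 : X) b = 0.
    have := ract_linearl b (-1) (0 : X) 0.
    by rewrite scaler0 add0r scaleN1r addNr.
  by rewrite [LHS]/(0 : X) l0 r0 addr0.
rewrite !cont_linE !cont_linZ d1 d2 lact_linearr ract_linearl scalerDr.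
by rewrite addrACA.
Qed.

HB.instance Definition _ := GRing.isSubmodClosed.Build _ _
  derivation_pred derivation_submod_closed.

Record derivations := Derivations {
  derivations_val :> cont_lin A X;
  derivationsP : derivations_val \in derivation_pred }.

HB.instance Definition _ := [isSub for derivations_val].
HB.instance Definition _ := [Choice of derivations by <:].
HB.instance Definition _ := [SubChoice_isSubLmodule of derivations by <:].

Let derivations_norm (z : derivations) : R[i] := `|val z|.

Let derivations_normD y z :
  derivations_norm (y + z) <= derivations_norm y + derivations_norm z.
Proof. exact: ler_normD. Qed.

Let derivations_normZ c z :
  derivations_norm (c *: z) = `|c| * derivations_norm z.
Proof. exact: normrZ. Qed.

Let derivations_norm_eq0 z : derivations_norm z = 0 -> z = 0.
Proof. by move=> /normr0_eq0 z0; apply: val_inj. Qed.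

HB.instance Definition _ := Lmodule_isNormed.Build R[i] derivations
  derivations_normD derivations_normZ derivations_norm_eq0.

End derivation_space.

(** * Surjectivity of an operator whose equation is solvable up to a factor *)

Section approximate_surjectivity.
Variables (R : realType) (E : completeNormedModType R[i]).
Variables (F : normedModType R[i]).

(** The order of the complex field is only partial, but B / e is nonnegative,
    hence real, and the Archimedean property applies to its real part. *)
Lemma half_power_small (B e : R[i]) : 0 <= B -> 0 < e ->
  exists n, B * 2^-1 ^+ n < e.
Proof.
move=> B0 e0; have Be : 0 <= B / e by rewrite divr_ge0// ltW.
exists (Num.bound (complex.Re (B / e))).
rewrite exprVn ltr_pdivrMr ?exprn_gt0// mulrC -ltr_pdivrMr// (real_ge0E Be).
rewrite -natrX -(rmorph_nat (@real_complex R)) ltcR natrX.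
exact: upper_nthrootP.
Qed.

(** This is the iteration at the heart of the open mapping theorem: an
    approximate solution of L x = y leaves a remainder of at most half the
    size, on which one starts again; since the size of a solution is
    controlled by that of the right-hand side, the corrections are summable. *)
Lemma approx_surjective (L : cont_lin E F) (C : R[i]) : 0 <= C ->
  (forall y, exists x, `|x| <= C * `|y| /\ `|y - L x| <= 2^-1 * `|y|) ->
  forall y, exists x, y = L x.
Proof.
move=> C0 /choice[T TP] y.
(* r n is the remainder after n corrections and s n their sum. *)
pose r n := iter n (fun v => v - L (T v)) y.
pose s n := \sum_(i < n) T (r i).
have r_le n : `|r n| <= `|y| * 2^-1 ^+ n.
  elim: n => [|n IH]; first by rewrite expr0 mulr1.
  apply: le_trans (TP (r n)).2 _; rewrite exprS mulrCA ler_wpM2l// invr_ge0.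
  exact: ler0n.
have rs n : y - L (s n) = r n.
  elim: n => [|n IH]; first by rewrite /s big_ord0 linear0 subr0.
  by rewrite /s big_ord_recr -/(s n) linearD opprD addrA IH.
pose K := C * `|y|; have K0 : 0 <= K by rewrite mulr_ge0.
have s_incr n : `|s n.+1 - s n| <= K * 2^-1 ^+ n.
  rewrite /s big_ord_recr -/(s n) addrAC subrr add0r.
  by apply: le_trans (TP (r n)).1 _; rewrite -mulrA ler_wpM2l.
(* Keeping the exact value of the geometric sum makes the induction work. *)
have s_dist n k :
    `|s (n + k)%N - s n| <= K * 2 * (2^-1 ^+ n - 2^-1 ^+ (n + k)).
  elim: k => [|k IH]; first by rewrite addn0 !subrr normr0 mulr0.
  rewrite addnS -(subrKA (s (n + k)%N)); apply: le_trans (ler_normD _ _) _.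
  apply: le_trans (lerD (s_incr _) IH) _.
  by rewrite le_eqVlt; apply/orP; left; apply/eqP; rewrite exprS; field.
have s_tail n k : `|s (n + k)%N - s n| <= K * 2 * 2^-1 ^+ n.
  apply: le_trans (s_dist n k) _; rewrite ler_wpM2l ?mulr_ge0// gerBl.
  by rewrite exprn_ge0// invr_ge0.
have : cvg (s @ \oo).
  apply: cauchy_cvg; apply/cauchy_ballP => e e0.
  have [n ne] : exists n, K * 4 * 2^-1 ^+ n < e.
    by apply: half_power_small => //; rewrite mulr_ge0.
  have tailn : (s @ \oo) (s @` [set m | (n <= m)%N]).
    by exists n => // m /= nm; exists m.
  exists (s @` [set m | (n <= m)%N], s @` [set m | (n <= m)%N]) => //.
  move=> [_ _] /= [[p /= np <-] [q /= nq <-]]; rewrite -ball_normE /=.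
  apply: le_lt_trans ne; rewrite -(subnKC np) -(subnKC nq) -(subrKA (s n)).
  apply: le_trans (ler_normD _ _) _; rewrite (distrC (s n)).
  apply: le_trans (lerD (s_tail _ _) (s_tail _ _)) _.
  by rewrite le_eqVlt; apply/orP; left; apply/eqP; ring.
move=> /cvg_ex[x sx]; exists x.
apply: (@cvg_unique _ (@norm_hausdorff _ F) (L \o s @ \oo)).
  apply/cvgrPdist_lt => e e0 /=.
  have [n ne] := half_power_small (normr_ge0 y) e0.
  exists n => // m /= nm; rewrite rs; apply: le_lt_trans (r_le m) _.
  apply: le_lt_trans ne; rewrite ler_wpM2l//.
  by rewrite ler_wiXn2l// ?invr_ge0// invf_le1// ler1n.
by apply: continuous_cvg sx; exact: cont_lin_continuous.
Qed.

End approximate_surjectivity.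

(** * Inner derivations and the universal derivation *)

Section inner_derivations.
Variables (R : realType) (A : banachAlgType R[i]).

(** The iteration below starts from one good approximation at a fixed
    precision, so the net is forgotten here. *)
Lemma uniformly_approx_innerP (X : banachBimodType A) (D : cont_lin A X) e :
  uniformly_approx_inner D -> 0 < e -> exists x, `|D - ad x| <= e.
Proof.
move=> [I [le [x [dir xD]]]] e0.
have [i /(_ i (directed_refl dir i))] := xD _ (nbhsx_ballx D e e0).
by rewrite -ball_normE /= => /ltW xe; exists (x i).
Qed.

Variable X : banachBimodType A.

Lemma ad_derivation (x : X) : derivation (ad x).
Proof.
move=> a b /=.
have lB (u v : X) : lact a (u - v) = lact a u - lact a v.
  by have := lact_linearr a (-1) v u; rewrite !scaleN1r ![- _ + _]addrC.
have rB (u v : X) : ract (u - v) b = ract u b - ract v b.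
  by have := ract_linearl b (-1) v u; rewrite !scaleN1r ![- _ + _]addrC.
by rewrite lB rB -lactA -ractA lract addrA subrK.
Qed.

Definition inner_derivation (x : X) : derivations X :=
  Derivations (asboolT (ad_derivation x)).

Let inner_derivation_linear : linear inner_derivation.
Proof.
move=> c x y; apply/val_inj/cont_lin_ext => a /=.
by rewrite lact_linearr ract_linearl scalerBr opprD addrACA.
Qed.

Let inner_derivation_continuous : continuous inner_derivation.
Proof.
have [M M0 lM] := lact_bounded X; have [N N0 rN] := ract_bounded X.
apply: (@linear_bounded_cont _ _ _ _ (M + N)) => // [|x].
  by rewrite addr_ge0.
apply: cont_lin_norm_le => [|a]; first by rewrite mulr_ge0// addr_ge0.
apply: le_trans (ler_normB _ _) _; apply: le_trans (lerD (lM _ _) (rN _ _)) _.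
by rewrite le_eqVlt; apply/orP; left; apply/eqP; ring.
Qed.

(** The decisive point is that C does not depend on z: this is what turns
    approximation by inner derivations into equality. *)
Lemma derivations_inner_of_approx (C : R[i]) : 0 <= C ->
  (forall z : derivations X, exists x : X,
     `|x| <= C * `|z| /\ `|(z : cont_lin A X) - ad x| <= 2^-1 * `|z|) ->
  forall D : cont_lin A X, derivation D -> inner D.
Proof.
move=> C0 approx D dD.
pose L := mk_cont_lin inner_derivation_linear inner_derivation_continuous.
have [x Dx] := approx_surjective (L := L) C0 approx (Derivations (asboolT dD)).
by exists x; exact: (congr1 val Dx).
Qed.

Local Notation W := (operators (derivations X) X).

Let evaluation_linear a : linear (fun z : derivations X => z a).
Proof. by []. Qed.

Let evaluation_continuous a : continuous (fun z : derivations X => z a).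
Proof.
apply: (linear_bounded_cont (normr_ge0 a) (evaluation_linear a)) => z.
by rewrite mulrC; exact: cont_lin_normP.
Qed.

Definition evaluation a : W :=
  mk_cont_lin (evaluation_linear a) (@evaluation_continuous a).

Let evaluation_norm a : `|evaluation a| <= 1 * `|a|.
Proof.
rewrite mul1r; apply: cont_lin_norm_le => // z.
by rewrite mulrC; exact: cont_lin_normP.
Qed.

Let universal_linear : linear evaluation.
Proof. by move=> c a b; apply: cont_lin_ext => z; exact: cont_lin_linear. Qed.

(** Universal because every derivation z is obtained from it by composing with
    one bimodule map, namely evaluation of operators at z. *)
Definition universal_derivation : cont_lin A W :=
  mk_cont_lin universal_linear
    (linear_bounded_cont ler01 universal_linear evaluation_norm).

(** At each z in Z the Leibniz rule for this map is the Leibniz rule for z. *)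
Lemma universal_derivationP : derivation universal_derivation.
Proof.
move=> a b; apply: cont_lin_ext => z.
by have /asboolP := derivationsP z; apply.
Qed.

End inner_derivations.

(** * From derivations into W to derivations into its bidual *)

Section bidual.
Variables (R : realType) (A : banachAlgType R[i]) (W : banachBimodType A).

Let embedding_linear (w : W) : linear (fun phi : dual W => phi w : R[i]^o).
Proof. by []. Qed.

Let embedding_continuous (w : W) :
  continuous (fun phi : dual W => phi w : R[i]^o).
Proof.
apply: (linear_bounded_cont (normr_ge0 w) (embedding_linear w)) => phi.
by rewrite mulrC; exact: cont_lin_normP.
Qed.

Definition canonical_embedding (w : W) : dual (dual W) :=
  mk_cont_lin (embedding_linear w) (@embedding_continuous w).

Variable D : cont_lin A W.

Let bidual_linear : linear (fun a => canonical_embedding (D a)).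
Proof.
by move=> c a b; apply: cont_lin_ext => phi /=; rewrite !cont_lin_linear.
Qed.

Let bidual_continuous : continuous (fun a => canonical_embedding (D a)).
Proof.
apply: (linear_bounded_cont (normr_ge0 D) bidual_linear) => a.
apply: cont_lin_norm_le => [|phi]; first by rewrite mulr_ge0.
rewrite mulrC; apply: le_trans (cont_lin_normP phi (D a)) _.
by rewrite ler_wpM2l// cont_lin_normP.
Qed.

Definition bidual_derivation : cont_lin A (dual (dual W)) :=
  mk_cont_lin bidual_linear bidual_continuous.

Lemma bidual_derivationP : derivation D -> derivation bidual_derivation.
Proof.
move=> dD a b; apply: cont_lin_ext => phi /=.
by rewrite dD linearD.
Qed.

End bidual.

(** * From the bidual of the operators into X^* back to X^* *)

Section predual_functionals.
Variables (R : realType) (A : banachAlgType R[i]) (X : banachBimodType A).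
Variable E : normedModType R[i].
Local Notation W := (operators E (dual X)).

Let operators_linear (z : E) (c : R[i]) (u v : W) :
  (c *: u + v) z = c *: u z + v z.
Proof. by []. Qed.

Let elementary_linear (z : E) (x : X) : linear (fun w : W => w z x : R[i]^o).
Proof. by move=> c u v; rewrite operators_linear. Qed.

Let elementary_bound (z : E) (x : X) (w : W) :
  `|w z x : R[i]^o| <= (`|z| * `|x|) * `|w|.
Proof.
apply: le_trans (cont_lin_normP _ _) _.
by rewrite mulrAC ler_wpM2r// mulrC cont_lin_normP.
Qed.

Let elementary_ge0 (z : E) (x : X) : 0 <= `|z| * `|x|.
Proof. exact: mulr_ge0. Qed.

(** The image of the elementary tensor z (x) x in W^*: the operators from E to
    X^* form the dual of the projective tensor product of E and X. *)
Definition elementary (z : E) (x : X) : dual W :=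
  mk_cont_lin (elementary_linear z x)
    (linear_bounded_cont (elementary_ge0 z x) (elementary_linear z x)
       (elementary_bound z x)).

Lemma elementary_norm z x : `|elementary z x| <= `|z| * `|x|.
Proof.
apply: cont_lin_norm_le => [|w]; first exact: elementary_ge0.
exact: elementary_bound.
Qed.

(** The actions are exchanged twice, from X to X^* and from W to W^*, so that
    the map from X to W^* preserves each of them. *)
Lemma elementary_ract z x a : elementary z (ract x a) = ract (elementary z x) a.
Proof. exact: cont_lin_ext. Qed.

Lemma elementary_lact z x a : elementary z (lact a x) = lact a (elementary z x).
Proof. exact: cont_lin_ext. Qed.

Variables (F : dual (dual W)) (z : E).

Let contract_linear : linear (fun x => F (elementary z x) : R[i]^o).
Proof.
move=> c x y; rewrite -cont_lin_linear; congr (F _).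
by apply: cont_lin_ext => w /=; rewrite cont_lin_linear.
Qed.

Let contract_bound x : `|F (elementary z x) : R[i]^o| <= `|F| * `|z| * `|x|.
Proof.
apply: le_trans (cont_lin_normP _ _) _.
by rewrite -mulrA ler_wpM2l// elementary_norm.
Qed.

Let contract_ge0 : 0 <= `|F| * `|z|.
Proof. exact: mulr_ge0. Qed.

(** This is the adjoint of x |-> elementary z x, applied to F. As a function of
    z it is the image of F under the projection of W^** onto W that exists
    because W is a dual space. *)
Definition contract : dual X :=
  mk_cont_lin contract_linear
    (linear_bounded_cont contract_ge0 contract_linear contract_bound).

Lemma contract_norm : `|contract| <= `|F| * `|z|.
Proof.
apply: cont_lin_norm_le => [|x]; first exact: contract_ge0.
exact: contract_bound.
Qed.

(** An adjoint of a bimodule map is a bimodule map, so it commutes with ad. *)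
Lemma contract_ad a x : ad contract a x = ad F a (elementary z x).
Proof.
rewrite !cont_linB !dual_lactE !dual_ractE /=.
by rewrite elementary_ract elementary_lact.
Qed.

End predual_functionals.

(** Restricted to the functionals w |-> w z x, the bidual of the universal
    derivation is z itself; the error made by F at all derivations at once
    therefore bounds the error made by its contraction at z. *)
Lemma contract_ad_dist (R : realType) (A : banachAlgType R[i])
    (X : banachBimodType A) (z : derivations (dual X)) F a x :
  ((z : cont_lin A (dual X)) - ad (contract F z)) a x =
  (bidual_derivation (universal_derivation (dual X)) - ad F) a (elementary z x).
Proof.
rewrite (cont_linB (val z)) [LHS]cont_linB contract_ad.
by rewrite (cont_linB (bidual_derivation _)) [RHS]cont_linB.
Qed.

Theorem corollary2p4 (R : realType) (A : banachAlgType R[i]) :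
  (uniformly_approx_contractible A -> contractible A) /\
  (uniformly_approx_amenable A -> amenable A).
Proof.
have half0 : 0 < 2^-1 :> R[i] by rewrite invr_gt0.
split=> approx X.
  (* T approximates, with one norm bound, for all derivations at once. *)
  have := approx _ _ (@universal_derivationP R A X).
  move=> /uniformly_approx_innerP/(_ half0)[T TP].
  apply: (derivations_inner_of_approx (normr_ge0 T)) => z; exists (T z).
  split; first exact: cont_lin_normP.
  apply: cont_lin_norm_le => [|a]; first by rewrite mulr_ge0// ltW.
  rewrite [X in `|X|](_ : _ = (universal_derivation X - ad T) a z) //.
  apply: le_trans (cont_lin_normP _ _) _; rewrite mulrAC ler_wpM2r//.
  apply: le_trans (cont_lin_normP _ _) _; exact: ler_wpM2r.
have := approx _ _ (bidual_derivationP (@universal_derivationP R A (dual X))).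
move=> /uniformly_approx_innerP/(_ half0)[F FP].
apply: (derivations_inner_of_approx (normr_ge0 F)) => z; exists (contract F z).
split; first exact: contract_norm.
apply: cont_lin_norm_le => [|a]; first by rewrite mulr_ge0// ltW.
apply: cont_lin_norm_le => [|x]; first by rewrite !mulr_ge0// ltW.
rewrite contract_ad_dist.
apply: le_trans (cont_lin_normP _ _) _.
apply: le_trans (ler_wpM2l (normr_ge0 _) (elementary_norm z x)) _.
rewrite mulrA ler_wpM2r// mulrAC ler_wpM2r//.
apply: le_trans (cont_lin_normP _ _) _; exact: ler_wpM2r.
Qed.
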